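(* Let $A=(a_{ij})\in\mathbb{R}^{n\times n}$ (the crisp coefficient matrix of a fuzzy system of linear equations $Ax=b$), and let $S\in\mathbb{R}^{2n\times 2n}$ be the associated matrix $S=\begin{pmatrix} S_1 & S_2\\ S_2 & S_1\end{pmatrix}$, where $S_1=(\alpha_{ij})\in\mathbb{R}^{n\times n}$ has entries $\alpha_{ij}=a_{ij}$ if $a_{ij}>0$ and $\alpha_{ij}=0$ otherwise, and $S_2=A-S_1$. (a) If $A$ is an H-matrix with positive diagonal entries, then $S$ is also an H-matrix. (b) If $A$ is an M-matrix, then $S$ is also an M-matrix.
   Context: A real matrix is called nonnegative ($\geq 0$) if all its entries are nonnegative. A square real matrix $B=(b_{ij})\in\mathbb{R}^{k\times k}$ is an M-matrix if $b_{ii}>0$ for all $i$, $b_{ij}\le 0$ for all $i\neq j$, $B$ is nonsingular, and $B^{-1}\ge 0$ entrywise. The comparison matrix $\mathcal{M}(B)=(m_{ij})$ is defined by $m_{ii}=|b_{ii}|$ and $m_{ij}=-|b_{ij}|$ for $i\ne j$. The matrix $B$ is an H-matrix if $\mathcal{M}(B)$ is an M-matrix. *)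

(* Defs.v *)
From mathcomp Require Import all_boot all_order all_algebra.
From mathcomp Require Import reals.

Set Implicit Arguments.
Unset Strict Implicit.
Unset Printing Implicit Defensive.

Import Order.TTheory GRing.Theory Num.Theory.
Local Open Scope ring_scope.

Definition nonneg_mx (R : realType) (m n : nat) (B : 'M[R]_(m, n)) : Prop :=
  forall i j, 0 <= B i j.

Definition M_matrix (R : realType) (k : nat) (B : 'M[R]_k) : Prop :=
  [/\ forall i, 0 < B i i,
      forall i j, i != j -> B i j <= 0,
      B \in unitmx
    & nonneg_mx (invmx B)].

Definition comparison_mx (R : realType) (k : nat) (B : 'M[R]_k) : 'M[R]_k :=
  \matrix_(i, j) (if i == j then `|B i j| else - `|B i j|).

Definition H_matrix (R : realType) (k : nat) (B : 'M[R]_k) : Prop :=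
  M_matrix (comparison_mx B).

Definition fuzzy_S1 (R : realType) (n : nat) (A : 'M[R]_n) : 'M[R]_n :=
  \matrix_(i, j) (if 0 < A i j then A i j else 0).

Definition fuzzy_S2 (R : realType) (n : nat) (A : 'M[R]_n) : 'M[R]_n :=
  A - fuzzy_S1 A.

Definition fuzzy_S (R : realType) (n : nat) (A : 'M[R]_n) : 'M[R]_(n + n) :=
  block_mx (fuzzy_S1 A) (fuzzy_S2 A) (fuzzy_S2 A) (fuzzy_S1 A).

(* Main.v *)
Require Import Defs.
From mathcomp Require Import all_boot all_order all_algebra.
From mathcomp Require Import reals.

Import Order.TTheory GRing.Theory Num.Theory.
Local Open Scope ring_scope.

(** Among the matrices with nonpositive off-diagonal entries, the M-matrices
    are exactly the semipositive ones: those with [B x > 0] for some [x >= 0]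
    ([M_matrix_semipositive] and [semipositive_M_matrix]).  A block matrix with
    rows [P Q] and [Q P] sends the doubled vector [(x, x)] to
    [((P + Q) x, (P + Q) x)].  So it inherits semipositivity from [P + Q], and
    with the right signs of [P] and [Q] it is an M-matrix as soon as [P + Q]
    is ([M_matrix_block_sym]).

    Both parts of the theorem are instances of this.  For an M-matrix [A], take
    [P = S1] and [Q = S2], whose sum is [A].  For an H-matrix [A] with positive
    diagonal, the comparison matrix of [S] has this block form, with [P] the
    comparison matrix of [S1] and [Q = - |S2|].  Then [P + Q] is the comparison
    matrix of [A], because at each position at most one of [S1] and [S2] is
    nonzero, and on the diagonal it is [S1]. *)

Section Semipositivity.

Variables (R : realType) (k : nat) (B : 'M[R]_k).
Hypothesis B_offdiag_le0 : forall i j, i != j -> B i j <= 0.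

(** For [x >= 0], only the diagonal term of row [i] of [B x] can be positive. *)
Lemma mulmx_le_diag (x : 'cV[R]_k) i :
  (forall j, 0 <= x j 0) -> (B *m x) i 0 <= B i i * x i 0.
Proof.
move=> x_ge0; rewrite mxE (bigD1 i) //= gerDl.
apply: sumr_le0 => j neq_ji; apply: mulr_le0_ge0 => //.
by apply: B_offdiag_le0; rewrite eq_sym.
Qed.

Variable x : 'cV[R]_k.
Hypotheses (x_ge0 : forall i, 0 <= x i 0) (Bx_gt0 : forall i, 0 < (B *m x) i 0).

Lemma semipositive_diag_mul_gt0 i : 0 < B i i * x i 0.
Proof. exact: lt_le_trans (Bx_gt0 i) (mulmx_le_diag _ i x_ge0). Qed.

Lemma semipositive_vector_gt0 i : 0 < x i 0.
Proof.
rewrite lt_neqAle x_ge0 andbT eq_sym; apply/eqP => xi0.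
by have := semipositive_diag_mul_gt0 i; rewrite xi0 mulr0 ltxx.
Qed.

(** Discrete minimum principle.  Let [t] be the least ratio [y j / x j],
    attained at [i].  Then [y - t x] is nonnegative and vanishes at [i], so
    [B (y - t x)] is nonpositive there; for negative [t] this contradicts
    [B y >= 0] and [B x > 0]. *)
Lemma semipositive_monotone (y : 'cV[R]_k) :
  (forall i, 0 <= (B *m y) i 0) -> forall i, 0 <= y i 0.
Proof.
move=> By_ge0 i0.
have [i _ i_min] := arg_minP (fun j => y j 0 / x j 0) (erefl : predT i0).
set t := y i 0 / x i 0 in i_min.
have z_ge0 j : 0 <= (y - t *: x) j 0.
  rewrite !mxE subr_ge0 -ler_pdivlMr ?semipositive_vector_gt0 //.
  exact: i_min.
have zi0 : (y - t *: x) i 0 = 0.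
  by rewrite !mxE divfK ?subrr // gt_eqF // semipositive_vector_gt0.
have t_ge0 : 0 <= t.
  have := mulmx_le_diag _ i z_ge0.
  rewrite zi0 mulr0 mulmxBr -scalemxAr.
  have -> : (B *m y - t *: (B *m x)) i 0 = (B *m y) i 0 - t * (B *m x) i 0.
    by rewrite [LHS]mxE [X in _ + X]mxE [X in _ - X]mxE.
  rewrite subr_le0 => /(le_trans (By_ge0 i)).
  by rewrite pmulr_lge0.
apply: le_trans (_ : t * x i0 0 <= _); first exact: mulr_ge0.
by have := z_ge0 i0; rewrite !mxE subr_ge0.
Qed.

(** Monotonicity gives invertibility, applied to [y] and [- y] when [B y = 0],
    and then nonnegativity of the inverse, applied to its columns.  The diagonal
    of [B] is positive because [B i i * x i] and [x i] are. *)
Lemma semipositive_M_matrix : M_matrix B.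
Proof.
have B_unit : B \in unitmx.
  (* Row-freeness speaks of left kernels, hence the transpose. *)
  rewrite -unitmx_tr -row_free_unit; apply: inj_row_free => v vB0.
  have Bv0 : B *m v^T = 0 by rewrite -[B]trmxK -trmx_mul vB0 trmx0.
  have v_ge0 := @semipositive_monotone v^T.
  have v_le0 := @semipositive_monotone (- v^T).
  apply/rowP => j; rewrite mxE; apply/eqP; rewrite eq_le; apply/andP; split.
    rewrite -oppr_ge0; have := v_le0 _ j; rewrite !mxE; apply=> i.
    by rewrite mulmxN Bv0 oppr0 mxE.
  by have := v_ge0 _ j; rewrite mxE; apply=> i; rewrite Bv0 mxE.
split=> // [i | i j].
  by have := semipositive_diag_mul_gt0 i; rewrite pmulr_lgt0 ?semipositive_vector_gt0.
have := @semipositive_monotone (col j (invmx B)) _ i.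
rewrite mxE; apply=> l.
by rewrite colE mulKVmx // mxE ler0n.
Qed.

End Semipositivity.

(** The nonnegative inverse maps the all-ones vector to such an [x]. *)
Lemma M_matrix_semipositive (R : realType) (k : nat) (B : 'M[R]_k) :
  M_matrix B ->
  exists2 x : 'cV[R]_k, forall i, 0 <= x i 0 & forall i, 0 < (B *m x) i 0.
Proof.
case=> _ _ B_unit invB_ge0; exists (invmx B *m const_mx 1) => i.
  by rewrite mxE; apply: sumr_ge0 => j _; rewrite mxE mulr1; apply: invB_ge0.
by rewrite mulKVmx // mxE ltr01.
Qed.

(** If [x] witnesses the semipositivity of [P + Q], then [(x, x)] witnesses that
    of the block matrix. *)
Lemma M_matrix_block_sym (R : realType) (n : nat) (P Q : 'M[R]_n) :
  (forall i j, i != j -> P i j <= 0) -> (forall i j, Q i j <= 0) ->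
  M_matrix (P + Q) -> M_matrix (block_mx P Q Q P).
Proof.
move=> P_le0 Q_le0 /M_matrix_semipositive[x x_ge0 PQx_gt0].
apply: (@semipositive_M_matrix _ _ _ _ (col_mx x x)) => [i j | i | i].
- case: (split_ordP i) => i' ->; case: (split_ordP j) => j' ->.
  + by rewrite block_mxEul (inj_eq (@lshift_inj _ _)); apply: P_le0.
  + by rewrite block_mxEur.
  + by rewrite block_mxEdl.
  + by rewrite block_mxEdr (inj_eq (@rshift_inj _ _)); apply: P_le0.
- by case: (split_ordP i) => i' ->; rewrite ?col_mxEu ?col_mxEd.
rewrite mul_block_col [Q *m x + _]addrC -mulmxDl.
by case: (split_ordP i) => i' ->; rewrite ?col_mxEu ?col_mxEd.
Qed.

Lemma comparison_block_mx (R : realType) (n : nat) (P Q : 'M[R]_n) :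
  comparison_mx (block_mx P Q Q P) =
  block_mx (comparison_mx P) (- map_mx Num.norm Q)
           (- map_mx Num.norm Q) (comparison_mx P).
Proof.
apply/matrixP => i j.
case: (split_ordP i) => i' ->; case: (split_ordP j) => j' ->; rewrite mxE.
- by rewrite !block_mxEul (inj_eq (@lshift_inj _ _)) mxE.
- by rewrite !block_mxEur eq_lrshift !mxE.
- by rewrite !block_mxEdl eq_rlshift !mxE.
- by rewrite !block_mxEdr (inj_eq (@rshift_inj _ _)) mxE.
Qed.

(** A negative diagonal entry of [A] would be moved to [S2], where its absolute
    value is subtracted, whereas the comparison matrix of [A] keeps it with a
    positive sign; this is why the diagonal of [A] has to be positive. *)
Lemma comparison_fuzzy_split (R : realType) (n : nat) (A : 'M[R]_n) :
  (forall i, 0 < A i i) ->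
  comparison_mx (fuzzy_S1 A) - map_mx Num.norm (fuzzy_S2 A) = comparison_mx A.
Proof.
move=> A_diag_gt0; apply/matrixP => i j; rewrite !mxE.
case: eqVneq => [<- | _]; first by rewrite A_diag_gt0 subrr normr0 subr0.
by case: ifP => _; rewrite ?subrr ?subr0 normr0 ?subr0 // oppr0 add0r.
Qed.

Theorem corollary1 (R : realType) (n : nat) (A : 'M[R]_n) :
  (H_matrix A -> (forall i, 0 < A i i) -> H_matrix (fuzzy_S A)) /\
  (M_matrix A -> M_matrix (fuzzy_S A)).
Proof.
split=> [A_H A_diag_gt0 | A_M].
  rewrite /H_matrix comparison_block_mx; apply: M_matrix_block_sym.
  - by move=> i j neq_ij; rewrite mxE (negPf neq_ij) oppr_le0.
  - by move=> i j; rewrite !mxE oppr_le0.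
  - by rewrite comparison_fuzzy_split.
have [_ A_offdiag_le0 _ _] := A_M.
apply: M_matrix_block_sym => [i j neq_ij | i j |].
- by rewrite mxE ltNge A_offdiag_le0.
- by rewrite !mxE; case: ltP; rewrite ?subrr ?subr0.
- by rewrite /fuzzy_S2 addrC subrK.
Qed.
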